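(* Let $(\mathfrak g,\omega,E)$ be a finite-dimensional perfect para-Kähler $3$-Lie algebra over $\mathbb R$ or $\mathbb C$, let $\mathfrak g_\pm$ be the eigenspaces of $E$ for the eigenvalues $\pm1$, let $\nabla$ be the Levi-Civita product associated to the bilinear form $S(x,y)=\omega(x,Ey)$, and let $\{\cdot,\cdot,\cdot\}$ be the $3$-pre-Lie multiplication on $\mathfrak g$ determined by $\omega(\{x,y,z\},w)=-\omega(z,[x,y,w]_{\mathfrak g})$. Then for all $x_1,x_2\in\mathfrak g_+$ and $\alpha_1,\alpha_2\in\mathfrak g_-$, $$\nabla_{x_1,x_2}\alpha_1=\{x_1,x_2,\alpha_1\}+\tfrac23\big(\{x_2,\alpha_1,x_1\}+\{\alpha_1,x_1,x_2\}\big),$$ $$\nabla_{\alpha_1,x_1}x_2=-\tfrac13\{\alpha_1,x_1,x_2\}+\tfrac23\{x_2,\alpha_1,x_1\},$$ $$\nabla_{\alpha_1,\alpha_2}x_1=\{\alpha_1,\alpha_2,x_1\}+\tfrac23\big(\{\alpha_2,x_1,\alpha_1\}+\{x_1,\alpha_1,\alpha_2\}\big),$$ $$\nabla_{x_1,\alpha_1}\alpha_2=-\tfrac13\{x_1,\alpha_1,\alpha_2\}+\tfrac23\{\alpha_2,x_1,\alpha_1\}.$$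
   Context: A $3$-Lie algebra is a vector space $\mathfrak g$ with a trilinear skew-symmetric bracket $[\cdot,\cdot,\cdot]_{\mathfrak g}$ satisfying $[x,y,[z,w,v]]=[[x,y,z],w,v]+[z,[x,y,w],v]+[z,w,[x,y,v]]$. A symplectic structure on $\mathfrak g$ is a nondegenerate skew-symmetric bilinear form $\omega$ with $\omega([x,y,z],w)-\omega([y,z,w],x)+\omega([z,w,x],y)-\omega([w,x,y],z)=0$ for all $x,y,z,w$. The multiplication $\{\cdot,\cdot,\cdot\}$ of the claim then satisfies $[x,y,z]_{\mathfrak g}=\{x,y,z\}+\{y,z,x\}+\{z,x,y\}$ (known fact). A perfect paracomplex structure on $\mathfrak g$ is a linear map $E:\mathfrak g\to\mathfrak g$ with $E^2=\mathrm{Id}$, $E\neq\pm\mathrm{Id}$, $E[x,y,z]_{\mathfrak g}=[Ex,Ey,Ez]_{\mathfrak g}$ for all $x,y,z$, whose $+1$- and $-1$-eigenspaces have the same dimension. A perfect para-Kähler $3$-Lie algebra is a triple $(\mathfrak g,\omega,E)$ with $\omega$ a symplectic structure, $E$ a perfect paracomplex structure and $\omega(Ex,Ey)=-\omega(x,y)$ for all $x,y\in\mathfrak g$. Then $S(x,y)=\omega(x,Ey)$ is a nondegenerate symmetric bilinear form. For a nondegenerate symmetric bilinear form $S$ on a $3$-Lie algebra $\mathfrak g$, the associated Levi-Civita product $\nabla:\mathfrak g^{\otimes3}\to\mathfrak g$, $(x,y,z)\mapsto\nabla_{x,y}z$, is defined by $$3S(\nabla_{x,y}z,w)=S([x,y,z]_{\mathfrak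 g},w)-2S([x,y,w]_{\mathfrak g},z)+S([y,z,w]_{\mathfrak g},x)+S([z,x,w]_{\mathfrak g},y)\quad\text{for all } w\in\mathfrak g.$$ *)

(* Defs.v *)
From HB Require Import structures.
From mathcomp Require Import all_boot all_order all_algebra.
From mathcomp Require Import reals complex.

Set Implicit Arguments.
Unset Strict Implicit.
Unset Printing Implicit Defensive.

Import GRing.Theory.
Local Open Scope ring_scope.

Inductive ground := RealGround | ComplexGround.

Definition ground_field (R : realType) (k : ground) : fieldType :=
  match k with RealGround => R | ComplexGround => R[i] end.

(* Skew-symmetry is stated for the two adjacent transpositions, which generate
   the symmetric group on the three arguments. *)
HB.mixin Record isThreeLie (K : fieldType) (V : Type) of Vector K V := {
  tbr : V -> V -> V -> V;
  tbr_linear1 : forall y z : V, linear (fun x => tbr x y z);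
  tbr_linear2 : forall x z : V, linear (fun y => tbr x y z);
  tbr_linear3 : forall x y : V, linear (fun z => tbr x y z);
  tbr_skew12 : forall x y z : V, tbr y x z = - tbr x y z;
  tbr_skew23 : forall x y z : V, tbr x z y = - tbr x y z;
  tbr_fundamental : forall x y z w v : V,
    tbr x y (tbr z w v) =
      tbr (tbr x y z) w v + tbr z (tbr x y w) v + tbr z w (tbr x y v)
}.

#[short(type="threeLieType")]
HB.structure Definition ThreeLie (K : fieldType) :=
  { V of isThreeLie K V & Vector K V }.

Section ThreeLieStructures.
Variables (K : fieldType) (g : threeLieType K).

Record symplectic_structure (omega : {skew_symmetric g}) : Prop := {
  symplectic_nondegenerate : nondegenerate omega;
  symplectic_closed : forall x y z w : g,
    omega (tbr x y z) w - omega (tbr y z w) x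
      + omega (tbr z w x) y - omega (tbr w x y) z = 0
}.

Record perfect_paracomplex_structure (E : 'End(g)) : Prop := {
  paracomplex_involutive : (E \o E)%VF = \1%VF;
  paracomplex_neq_id : E <> \1%VF;
  paracomplex_neq_opp_id : E <> - \1%VF;
  paracomplex_tbr : forall x y z : g, E (tbr x y z) = tbr (E x) (E y) (E z);
  paracomplex_dim : \dim (passmx.leigenspace E 1) = \dim (passmx.leigenspace E (- 1))
}.

Record perfect_para_Kahler (omega : {skew_symmetric g}) (E : 'End(g)) : Prop := {
  para_Kahler_symplectic : symplectic_structure omega;
  para_Kahler_paracomplex : perfect_paracomplex_structure E;
  para_Kahler_compatible : forall x y : g, omega (E x) (E y) = - omega x y
}.

Definition para_Kahler_form (omega : {skew_symmetric g}) (E : 'End(g)) :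
    g -> g -> K :=
  fun x y => omega x (E y).

(* [nabla x y z] is $\nabla_{x,y} z$; for nondegenerate [S] there is exactly
   one such [nabla]. *)
Definition Levi_Civita_product (S : g -> g -> K) (nabla : g -> g -> g -> g) :=
  forall x y z w : g,
    3 * S (nabla x y z) w =
      S (tbr x y z) w - 2 * S (tbr x y w) z
        + S (tbr y z w) x + S (tbr z x w) y.

(* For nondegenerate [omega] there is exactly one such [pl]. *)
Definition symplectic_preLie_product (omega : {skew_symmetric g})
    (pl : g -> g -> g -> g) :=
  forall x y z w : g, omega (pl x y z) w = - omega z (tbr x y w).

End ThreeLieStructures.

(* Main.v *)
Require Import Defs.
From HB Require Import structures.
From mathcomp Require Import all_boot all_order all_algebra.
From mathcomp Require Import reals complex.
From mathcomp Require Import ring.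

(** On eigenvectors of [E], the Levi-Civita product is a linear combination of
    the three cyclic permutations of the 3-pre-Lie product, with coefficients
    that depend only on the eigenvalues.

    The relation defining [nabla x y z] is tested against vectors of the form
    [E w], so that [S (nabla x y z) (E w) = omega (nabla x y z) w].  Suppose
    that [x], [y], [z] are eigenvectors of [E] for the signs [a], [b], [c].
    As [E] is an involutive automorphism of the bracket, it comes out of
    [[x, y, E w]] with the sign [a * b]; as it is an anti-isometry of [omega],
    it then disappears from [omega [x, y, E w] (E z)] at the price of one more
    sign ([para_Kahler_form_tbr]).  What remains is
    [omega z [x, y, w]], which is [- omega (pl x y z) w].  The term containing
    [[x, y, z]] is the cyclic sum of the pre-Lie products, since this is how
    the closedness of [omega] reads in terms of [pl]
    ([symplectic_tbr_preLie]).  Nondegeneracy of [omega] yields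
    [3 nabla x y z = (1 + 2 a b) pl x y z + (1 - b c) pl y z x
                     + (1 - c a) pl z x y]
    ([Levi_Civita_preLie]).  The four formulas are its instances for the signs
    [(+, +, -)], [(-, +, +)], [(-, -, +)] and [(+, -, -)]. *)

Set Implicit Arguments.
Unset Strict Implicit.
Unset Printing Implicit Defensive.

Import GRing.Theory.
Local Open Scope ring_scope.

Section SymplecticThreeLie.
Variables (K : fieldType) (g : threeLieType K) (omega : {skew_symmetric g}).

Lemma skew_symmetricC (u v : g) : omega u v = - omega v u.
Proof. by rewrite hermC /= expr1 mulN1r. Qed.

Lemma nondegenerate_inj (u v : g) :
  nondegenerate omega -> (forall w, omega u w = omega v w) -> u = v.
Proof.
move=> /eqP nd euv; apply/eqP; rewrite -subr_eq0 -memv0 -nd.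
by apply/mem_orthovP => w _; rewrite linearBl /= euv subrr.
Qed.

(** Closedness of [omega], once [[z, w, x]] and [[w, x, y]] are brought to
    the form [- [z, x, w]] and [[x, y, w]] that defines [pl]. *)
Lemma symplectic_tbr_preLie (pl : g -> g -> g -> g) (x y z w : g) :
    symplectic_structure omega -> symplectic_preLie_product omega pl ->
  omega (tbr x y z) w =
    omega (pl x y z) w + omega (pl y z x) w + omega (pl z x y) w.
Proof.
move=> [_ closed] plP; move: (closed x y z w); rewrite !plP.
have -> : tbr z w x = - tbr z x w by rewrite tbr_skew23.
have -> : tbr w x y = tbr x y w by rewrite tbr_skew12 tbr_skew23 opprK.
rewrite -!(skew_symmetricC (tbr _ _ _)) linearNl /= => h.
by apply/eqP; rewrite -subr_eq0 -h; apply/eqP; ring.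
Qed.

End SymplecticThreeLie.

Section ParaKahler.
Variables (K : fieldType) (g : threeLieType K).
Variables (omega : {skew_symmetric g}) (E : 'End(g)).
Hypothesis omegaE : perfect_para_Kahler omega E.
Variables (pl : g -> g -> g -> g) (plP : symplectic_preLie_product omega pl).

Let EK (u : g) : E (E u) = u.
Proof.
have /lfunP/(_ u) := paracomplex_involutive (para_Kahler_paracomplex omegaE).
by rewrite comp_lfunE id_lfunE.
Qed.

(** [E] is carried from the third slot of the bracket to its value, where it
    meets the [E] hidden in the form and both cancel up to sign. *)
Lemma para_Kahler_form_tbr (a b : K) (x y z w : g) :
    a ^+ 2 = 1 -> b ^+ 2 = 1 -> E x = a *: x -> E y = b *: y ->
  para_Kahler_form omega E (tbr x y (E w)) z = - (a * b) * omega (pl x y z) w.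
Proof.
move=> a2 b2 Ex Ey; rewrite /para_Kahler_form.
have tbrZ1 (t : K) u v s : tbr (t *: u) v s = t *: tbr u v s :> g.
  exact: (scalable_linear (tbr_linear1 v s)).
have tbrZ2 (t : K) u v s : tbr u (t *: v) s = t *: tbr u v s :> g.
  exact: (scalable_linear (tbr_linear2 u s)).
have -> : tbr x y (E w) = (a * b) *: E (tbr x y w).
  rewrite (paracomplex_tbr (para_Kahler_paracomplex omegaE)) Ex Ey tbrZ1 tbrZ2.
  rewrite !scalerA -[LHS]scale1r; congr (_ *: _).
  by transitivity (a ^+ 2 * b ^+ 2); [rewrite a2 b2 mulr1 | ring].
rewrite linearZl_LR /= (para_Kahler_compatible omegaE) plP.
by rewrite (skew_symmetricC _ z); ring.
Qed.

Lemma Levi_Civita_preLie (nabla : g -> g -> g -> g) (a b c : K) (x y z : g) :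
    Levi_Civita_product (para_Kahler_form omega E) nabla ->
    a ^+ 2 = 1 -> b ^+ 2 = 1 -> c ^+ 2 = 1 ->
    E x = a *: x -> E y = b *: y -> E z = c *: z ->
  3 *: nabla x y z =
    (1 + 2 * (a * b)) *: pl x y z + (1 - b * c) *: pl y z x
      + (1 - c * a) *: pl z x y.
Proof.
move=> nablaP a2 b2 c2 Ex Ey Ez.
apply: (nondegenerate_inj (symplectic_nondegenerate
  (para_Kahler_symplectic omegaE))) => w.
rewrite !linearDl /= !linearZl_LR /=.
(* Testing against E w rather than w makes S (nabla x y z) (E w) equal to
   omega (nabla x y z) w. *)
have := nablaP x y z (E w).
rewrite (para_Kahler_form_tbr _ _ a2 b2) // (para_Kahler_form_tbr _ _ b2 c2) //.
rewrite (para_Kahler_form_tbr _ _ c2 a2) // /para_Kahler_form EK => ->.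
rewrite (symplectic_tbr_preLie _ _ _ _ (para_Kahler_symplectic omegaE) plP).
by ring.
Qed.

End ParaKahler.

Lemma ground_field_3_neq0 (R : realType) (k : ground) :
  3 != 0 :> ground_field R k.
Proof. by case: k => /=; rewrite Num.Theory.pnatr_eq0. Qed.

Lemma leigenspaceP (K : fieldType) (V : vectType K) (f : 'End(V)) (a : K)
    (x : V) : x \in passmx.leigenspace f a -> f x = a *: x.
Proof.
rewrite memv_ker !lfunE /= opp_lfunE scale_lfunE id_lfunE subr_eq0.
by move/eqP.
Qed.

Theorem proposition8p11 (R : realType) (k : ground)
    (g : threeLieType (ground_field R k))
    (omega : {skew_symmetric g}) (E : 'End(g))
    (omegaE : perfect_para_Kahler omega E)
    (nabla : g -> g -> g -> g)
    (nablaP : Levi_Civita_product (para_Kahler_form omega E) nabla)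
    (pl : g -> g -> g -> g) (plP : symplectic_preLie_product omega pl)
    (x1 x2 a1 a2 : g)
    (x1P : x1 \in passmx.leigenspace E 1) (x2P : x2 \in passmx.leigenspace E 1)
    (a1P : a1 \in passmx.leigenspace E (- 1)) (a2P : a2 \in passmx.leigenspace E (- 1)) :
  [/\ nabla x1 x2 a1 = pl x1 x2 a1 + (2 / 3) *: (pl x2 a1 x1 + pl a1 x1 x2),
      nabla a1 x1 x2 = - (1 / 3) *: pl a1 x1 x2 + (2 / 3) *: pl x2 a1 x1,
      nabla a1 a2 x1 = pl a1 a2 x1 + (2 / 3) *: (pl a2 x1 a1 + pl x1 a1 a2)
    & nabla x1 a1 a2 = - (1 / 3) *: pl x1 a1 a2 + (2 / 3) *: pl a2 x1 a1].
Proof.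
have n3 := ground_field_3_neq0 R k.
have sq1 : 1 ^+ 2 = 1 :> ground_field R k by rewrite expr1n.
have sqN1 : (- 1) ^+ 2 = 1 :> ground_field R k by rewrite sqrrN expr1n.
move: (leigenspaceP x1P) (leigenspaceP x2P) => Ex1 Ex2.
move: (leigenspaceP a1P) (leigenspaceP a2P) => Ea1 Ea2.
have LC := Levi_Civita_preLie omegaE plP nablaP.
split; apply: (scalerI n3).
- rewrite (LC 1 1 (- 1)) // !scalerDr !scalerA addrA.
  by congr (_ *: _ + _ *: _ + _ *: _); field.
- rewrite (LC (- 1) 1 1) // !scalerDr !scalerA.
  rewrite (_ : 1 - 1 * 1 = 0) ?scale0r ?addr0; last by ring.
  by congr (_ *: _ + _ *: _); field.
- rewrite (LC (- 1) (- 1) 1) // !scalerDr !scalerA addrA.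
  by congr (_ *: _ + _ *: _ + _ *: _); field.
- rewrite (LC 1 (- 1) (- 1)) // !scalerDr !scalerA.
  rewrite (_ : 1 - - 1 * - 1 = 0) ?scale0r ?addr0; last by ring.
  by congr (_ *: _ + _ *: _); field.
Qed.
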